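(* Let $h$ be a real function and $r$ a non-decreasing function on an interval $(a,b]$. Then the function $$\mathbf{g}(z):=\int_a^b\frac{h(s)}{z\,h(s)+1}\,dr(s)$$ maps the upper half-plane $\mathbb{C}^+$ into the lower half-plane $\mathbb{C}^-$, is analytic, and has the Pick–Nevanlinna representation $$\mathbf{g}(z)=\int_a^b\frac{h(s)}{1+h^2(s)}\,dr(s)+\int_{\mathbb{R}}\frac{1+zx}{z-x}\,m(dx),\qquad z\in\mathbb{C}^+,$$ where $m$ is the measure on $\mathbb{R}$ $$m(A):=\int_a^b\frac{h^2(s)}{1+h^2(s)}\,\delta_{-1/h(s)}(A)\,dr(s)\qquad\text{for Borel sets }A.$$
   Context: $\mathbb{C}^+=\{\Im z>0\}$, $\mathbb{C}^-=\{\Im z<0\}$, and $\delta_y$ is the Dirac point mass at $y$. The function $\mathbf{g}$ is the kernel appearing in the free-infinitely divisible transform of the random integral $\int_{(a,b]}h(t)\,dY(r(t))$, where $Y$ is a Lévy process; $h$ is the deterministic real integrand and $r$ the monotone nonnegative deterministic time change of that integral, and the integrals defining $\mathbf{g}$ and $m$ are assumed to be well defined.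
   Formalization: The claim that g maps C^+ into C^- is stated only when h is not zero dr-almost everywhere on (a,b]; if h = 0 dr-a.e. (e.g. h = 0 or r constant), then g is identically 0 and the claim fails. *)

(* Defs.v *)
From HB Require Import structures.
From mathcomp Require Import all_boot all_order all_algebra.
From mathcomp Require Import all_classical all_reals all_analysis.
From mathcomp Require Export complex.
Import Order.TTheory GRing.Theory Num.Theory.
Import numFieldNormedType.Exports.

Set Implicit Arguments.
Unset Strict Implicit.
Unset Printing Implicit Defensive.

Local Open Scope classical_set_scope.
Local Open Scope ring_scope.

(** [r] need not be right-continuous, so [dr] is generated by [s |-> r (s+)],
    with the convention [r (b+) = r b].  That function is extended to the whole
    line by [r (a+)] on the left of [a] and by [r b] on the right of [b], so that
    [dr] has no mass outside [`]a, b]].  For [r] non-decreasing on [`]a, b]] and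
    [x < b], the infimum below is the right limit [r (max a x +)]. *)
Definition rlim {R : realType} (a b : R) (r : R -> R) (x : R) : R :=
  if x < b then inf (r @` `]Num.max a x, b]) else r b.

Section stieltjes.
Context {R : realType} {a b : R} {r : R -> R}.
Hypothesis ab : a < b.
Hypothesis r_ge0 : {in `]a, b], forall s, 0 <= r s}.

Let img_nonempty x : x < b -> r @` `]Num.max a x, b] !=set0.
Proof.
by move=> xb; exists (r b), b => //=; rewrite in_itv/= lexx gt_max ab xb.
Qed.

Let img_lb x : lbound (r @` `]Num.max a x, b]) 0.
Proof.
move=> _ [s /= + <-]; rewrite in_itv/= gt_max => /andP[/andP[as_ _] sb].
by apply: r_ge0; rewrite in_itv/= as_ sb.
Qed.

Let rlim_le x y : x < b -> Num.max a x < y -> y <= b -> rlim a b r x <= r y.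
Proof.
move=> xb xy yb; rewrite /rlim xb; apply: ge_inf; first by exists 0; exact: img_lb.
by exists y => //=; rewrite in_itv/= xy.
Qed.

Lemma rlim_nondecreasing : nondecreasing (rlim a b r).
Proof.
move=> x y xy; rewrite {2}/rlim; case: ltP => yb; last first.
  have [xb|xb] := ltP x b; first by apply: rlim_le; rewrite // gt_max ab xb.
  by rewrite /rlim ltNge xb.
apply: lb_le_inf; first exact: img_nonempty.
move=> _ [s /= + <-]; rewrite in_itv/= => /andP[ys sb].
apply: rlim_le => //; first exact: le_lt_trans yb.
move: ys; rewrite !gt_max => /andP[-> ys] /=; exact: le_lt_trans ys.
Qed.

Lemma rlim_right_continuous : right_continuous (rlim a b r).
Proof.
move=> x; have [xb|bx] := ltP x b; last first.
  apply: cvg_near_cst; near=> y.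
  have xy : x < y by near: y; exact: nbhs_right_gt.
  by rewrite /rlim !ltNge bx (le_trans bx (ltW xy)).
apply/cvgrPdist_lt => e e0.
have hi : has_inf (r @` `]Num.max a x, b]).
  by split; [exact: img_nonempty|exists 0; exact: img_lb].
have [_ [s /= + <-] rs] := inf_adherent e0 hi; rewrite in_itv/= => /andP[xs sb].
near=> y.
have xy : x < y by near: y; exact: nbhs_right_gt.
have ys : y < s.
  by near: y; apply: nbhs_right_lt; move: xs; rewrite gt_max => /andP[].
rewrite distrC ger0_norm ?subr_ge0 ?rlim_nondecreasing// 1?ltW//.
rewrite ltrBlDr addrC; apply: le_lt_trans (_ : r s < _); last first.
  by rewrite {1}/rlim xb.
have asl : a < s by move: (xs); rewrite gt_max => /andP[].
by apply: rlim_le; rewrite ?gt_max ?asl ?ys// (lt_le_trans ys).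
Unshelve. all: by end_near. Qed.

Definition stieltjes_cumulative : cumulative R R :=
  HB.pack (rlim a b r)
    (isCumulative.Build R _ R (rlim a b r)
      rlim_nondecreasing rlim_right_continuous).

Definition stieltjes : {measure set (measurableTypeR R) -> \bar R} :=
  lebesgue_stieltjes_measure stieltjes_cumulative.

Lemma stieltjes_itv (c d : R) : c <= d ->
  stieltjes `]c, d]%classic = (rlim a b r d - rlim a b r c)%:E.
Proof.
move=> cd; transitivity (wlength stieltjes_cumulative `]c, d]%classic).
  by apply: measurable_mu_extE; exact: is_ocitv.
exact: wlength_itv_bnd.
Qed.

End stieltjes.

Section complex_integral.
Context {d : measure_display} {T : measurableType d} {R : realType}.

(** Complex integrals are taken componentwise. *)
Definition cintegrable (mu : {measure set T -> \bar R}) (D : set T)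
    (f : T -> R[i]) : Prop :=
  mu.-integrable D (fun x => (complex.Re (f x))%:E) /\
  mu.-integrable D (fun x => (complex.Im (f x))%:E).

Definition cintegral (mu : {measure set T -> \bar R}) (D : set T)
    (f : T -> R[i]) : R[i] :=
  (Rintegral mu D (fun x => complex.Re (f x)) +i*
   Rintegral mu D (fun x => complex.Im (f x)))%C.

End complex_integral.

(** [R[i]^o] is [R[i]] with the topology of its modulus. *)
Definition analytic_on {R : realType} (D : set R[i]) (f : R[i] -> R[i]) : Prop :=
  forall z0 : R[i]^o, D z0 -> exists c : nat -> R[i]^o,
    \forall z \near z0,
      series (fun n => c n * (z - z0) ^+ n : R[i]^o) @ \oo --> (f z : R[i]^o).

Definition upper_half_plane {R : realType} : set R[i] :=
  [set z | 0 < complex.Im z].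

Definition lower_half_plane {R : realType} : set R[i] :=
  [set z | complex.Im z < 0].

Section objects.
Context {R : realType}.
Local Notation RT := (measurableTypeR R).
Variables (dr : {measure set RT -> \bar R}) (a b : R) (h : R -> R).

Definition g_integrand (z : R[i]) (s : R) : R[i] :=
  (h s)%:C%C / (z * (h s)%:C%C + 1).

Definition g (z : R[i]) : R[i] := cintegral dr `]a, b] (g_integrand z).

(** Where [h s = 0], the convention [- 0^-1 = 0] places the Dirac mass at [0],
    but with weight [0]. *)
Definition m (A : set RT) : \bar R :=
  (\int[dr]_(s in `]a, b])
     ((h s ^+ 2 / (1 + h s ^+ 2))%R%:E * \d_(- (h s)^-1)%R A))%E.

End objects.

Definition pick_kernel {R : realType} (z : R[i]) (x : R) : R[i] :=
  (1 + z * x%:C%C) / (z - x%:C%C).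

(* Main.v *)
Require Import Defs.
From HB Require Import structures.
From mathcomp Require Import all_boot all_order all_algebra.
From mathcomp Require Import all_classical all_reals all_analysis.
From mathcomp Require Import measurable_realfun ring lra.
Import Order.TTheory GRing.Theory Num.Theory.
Import numFieldNormedType.Exports.

(** With [w = h/(z0 h + 1)], the integrand [h/(zh+1)] equals
    [w / (1 + (z - z0) w)], and [|w| <= 1 / Im z0]; integrating the geometric
    series, whose remainder is [h/(zh+1) * ((z0 - z) w)^n], gives the power
    series of [g] at [z0].  The sign of [Im g] is read off
    [Im (h/(zh+1)) = - Im z * h^2 / |zh+1|^2].
    For the representation, with [x = -1/h] one has pointwise
    [h/(zh+1) = h/(1+h^2) + h^2/(1+h^2) * (1+zx)/(z-x)], while [m] is the image
    under [x] of the measure of density [h^2/(1+h^2)].  Both real functions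
    [h/(1+h^2)] and [h^2/(1+h^2)] are integrable because, up to sign, they are
    the real and imaginary parts of the integrand at [z = i]. *)

Local Open Scope classical_set_scope.
Local Open Scope ring_scope.

Lemma measurable_invr (R : realType) :
  measurable_fun [set: R] (GRing.inv : R -> R).
Proof.
(* Both sides vanish at [0], where [0^-1 = 0]. *)
rewrite (_ : GRing.inv = fun x : R => x * (x ^+ 2) `^ (- 1)).
  apply: measurable_funM => //.
  apply: (measurableT_comp (measurable_powR (-1))).
  exact: exprn_measurable.
apply/funext => x; rewrite powR_inv1 ?sqr_ge0//.
have [->|x0] := eqVneq x 0; first by rewrite invr0 mul0r.
by field.
Qed.

(** * Images of measures with a density *)

Section weighted_image.
Context {d1 d2 : measure_display} {X : measurableType d1}
  {Y : measurableType d2} {R : realType}.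
Variables (mu : {measure set X -> \bar R}) (D : set X) (k : X -> R)
  (phi : X -> Y).
Local Open Scope ereal_scope.

(** The image under [phi] of the measure of density [k] on [D]. The Dirac mass stays under the
    integral so that [m] is literally an instance. *)
Definition weighted_image (A : set Y) : \bar R :=
  \int[mu]_(x in D) ((k x)%:E * \d_(phi x) A).

Hypotheses (mD : measurable D) (mk : measurable_fun D k)
  (mphi : measurable_fun D phi) (k_ge0 : forall x, (0 <= k x)%R).

Let measurable_weight A : measurable A ->
  measurable_fun D (fun x => (k x)%:E * \d_(phi x) A : \bar R).
Proof.
move=> mA; apply: emeasurable_funM; first exact/measurable_EFinP.
apply: (measurableT_comp (f := fun y => \d_y A : \bar R)) => //.
exact: measurable_fun_dirac.
Qed.

Let weight_ge0 A x : 0 <= (k x)%:E * \d_(phi x) A :> \bar R.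
Proof. by rewrite mule_ge0// lee_fin. Qed.

Let weighted_image0 : weighted_image set0 = 0.
Proof.
by rewrite /weighted_image integral0_eq// => x _; rewrite measure0 mule0.
Qed.

Let weighted_image_ge0 A : 0 <= weighted_image A.
Proof. by apply: integral_ge0 => x _; exact: weight_ge0. Qed.

(** All terms are nonnegative, so the integral and the series may be exchanged; pointwise,
    additivity is that of the Dirac mass. *)
Let weighted_image_sigma_additive : semi_sigma_additive weighted_image.
Proof.
move=> F mF tF mUF.
have -> : weighted_image (\bigcup_n F n) = \sum_(n <oo) weighted_image (F n).
  rewrite /weighted_image -integral_nneseries//; last first.
    by move=> n; exact: measurable_weight.
  apply: eq_integral => x _.
  rewrite measure_semi_bigcup// nneseriesZl//.
by apply: is_cvg_nneseries => n _ _; exact: weighted_image_ge0.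
Qed.

HB.instance Definition _ := isMeasure.Build _ _ _ weighted_image
  weighted_image0 weighted_image_ge0 weighted_image_sigma_additive.

Definition weighted_image_measure : {measure set Y -> \bar R} := weighted_image.

Import HBNNSimple.

(** Monotone convergence on both sides reduces to simple functions, linearity to indicators of level
    sets, and for these the identity is the definition of [weighted_image]. *)
Lemma ge0_integral_weighted_image (f : Y -> \bar R) :
  measurable_fun setT f -> (forall y, 0 <= f y) ->
  \int[weighted_image_measure]_y f y =
  \int[mu]_(x in D) ((k x)%:E * f (phi x)).
Proof.
move=> mf f0; pose f_ := nnsfun_approx measurableT mf.
have mkf n : measurable_fun D (fun x => (k x)%:E * (f_ n (phi x))%:E : \bar R).
  apply: emeasurable_funM; first exact/measurable_EFinP.
  by apply/measurable_EFinP; exact: measurableT_comp.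
transitivity (limn (fun n => \int[weighted_image_measure]_y (f_ n y)%:E)).
  rewrite -monotone_convergence//.
  - by apply: eq_integral => y _; apply/esym/cvg_lim => //; exact: cvg_nnsfun_approx.
  - by move=> n; exact/measurable_EFinP.
  - by move=> n y _; rewrite lee_fin.
  - by move=> y _ p q pq; rewrite lee_fin; exact/lefP/nd_nnsfun_approx.
transitivity (limn (fun n =>
    \int[mu]_(x in D) ((k x)%:E * (f_ n (phi x))%:E))); last first.
  rewrite -monotone_convergence//; last 2 first.
  - by move=> n x _; rewrite mule_ge0 ?lee_fin.
  - move=> x _ p q pq; rewrite lee_wpmul2l ?lee_fin//.
    exact/lefP/nd_nnsfun_approx.
  apply: eq_integral => x _; apply/cvg_lim => //.
  by apply: cvgeZl => //; exact: cvg_nnsfun_approx.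
congr (limn _); apply/funext => n.
under eq_integral do rewrite fimfunE -fsumEFin//.
rewrite ge0_integral_fsum//; last 2 first.
- by move=> r; exact/measurable_EFinP/measurable_funM.
- by move=> r x _; rewrite nnfun_muleindic_ge0.
have mindic r : measurable_fun D (fun x =>
    (k x * (r * \1_(f_ n @^-1` [set r]) (phi x)))%:E : \bar R).
  apply/measurable_EFinP/measurable_funM => //; apply: measurable_funM => //.
  by apply: measurableT_comp mphi; exact: measurable_indic.
have indic_ge0 r x :
    0 <= (k x * (r * \1_(f_ n @^-1` [set r]) (phi x)))%:E :> \bar R.
  by rewrite EFinM mule_ge0 ?lee_fin// -lee_fin nnfun_muleindic_ge0.
transitivity (\sum_(r \in range (f_ n))
    \int[mu]_(x in D) (k x * (r * \1_(f_ n @^-1` [set r]) (phi x)))%:E); last first.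
  rewrite -ge0_integral_fsum//.
  apply: eq_integral => x _; rewrite fsumEFin// -EFinM; congr _%:E.
  rewrite [in RHS](fimfunE (f_ n)) -/(f_ n) !fsbig_finite//= mulr_sumr//.
apply: eq_fsbigr => r _.
rewrite integralZl_indic_nnsfun// integral_indic//= setIT.
have mr : measurable (f_ n @^-1` [set r]) by [].
rewrite [RHS](_ : _ = \int[mu]_(x in D) (r%:E * ((k x)%:E * \d_(phi x) (f_ n @^-1` [set r])))); last first.
  by apply: eq_integral => x _; rewrite !EFinM muleCA.
(* A factor [r >= 0] comes out of the integral; for [r < 0] the level set of the nonnegative [f_ n]
   is empty and both sides vanish. *)
have [r0|r0] := leP 0%R r; first by rewrite ge0_integralZl//; exact: measurable_weight.
rewrite preimage_nnfun0// measure0 mule0 integral0_eq// => x _.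
by rewrite measure0 !mule0.
Qed.

(** Multiplication by [k x >= 0] commutes with positive and negative parts, so the nonnegative case
    applies to each part. *)
Lemma integral_weighted_image (f : Y -> R) :
  measurable_fun setT f ->
  \int[weighted_image_measure]_y (f y)%:E =
  \int[mu]_(x in D) (k x * f (phi x))%:E.
Proof.
move=> mf; have mf' : measurable_fun setT (EFin \o f) by exact/measurable_EFinP.
rewrite integralE [RHS]integralE.
rewrite !ge0_integral_weighted_image//; last 2 first.
- exact: measurable_funeneg.
- exact: measurable_funepos.
congr (_ - _); apply: eq_integral => x _.
- by rewrite !funeposE EFinM maxe_pMr ?lee_fin ?mule0.
- by rewrite !funenegE EFinM -muleN maxe_pMr ?lee_fin ?mule0.
Qed.

Lemma integrable_weighted_image (f : Y -> R) : measurable_fun setT f ->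
  mu.-integrable D (fun x => (k x * f (phi x))%:E) ->
  weighted_image_measure.-integrable setT (fun y => (f y)%:E).
Proof.
move=> mf /integrableP[_ foo]; apply/integrableP; split.
  exact/measurable_EFinP.
rewrite ge0_integral_weighted_image//; last first.
  by do 2 apply: measurableT_comp => //; exact/measurable_EFinP.
apply: le_lt_trans foo; rewrite le_eqVlt; apply/orP; left; apply/eqP.
by apply: eq_integral => x _; rewrite EFinM abseM [`|(k x)%:E|]gee0_abs ?lee_fin.
Qed.

Hypothesis ik : mu.-integrable D (EFin \o k).

(** The total mass is the integral of [k], since every Dirac mass gives 1 to the whole space. *)
Let weighted_imageT_fin : fin_num_fun weighted_image.
Proof.
apply: lty_fin_num_fun => /=; case/integrableP : ik => _.
rewrite /weighted_image; under eq_integral do rewrite gee0_abs ?lee_fin//.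
by under [in X in _ -> X]eq_integral do rewrite diracT mule1.
Qed.

HB.instance Definition _ :=
  Measure_isFinite.Build _ _ _ weighted_image weighted_imageT_fin.

Definition weighted_image_finite_measure :
  {finite_measure set Y -> \bar R} := weighted_image.

End weighted_image.

(** * Complex-valued functions: norm, measurability, integration *)

Lemma normc_ge_Im (R : rcfType) (x : R[i]) : (`|complex.Im x|)%:C%C <= `|x|.
Proof.
by rewrite normc_def lecR -sqrtr_sqr ler_wsqrtr// lerDr sqr_ge0.
Qed.

Lemma normc_le_ReIm (R : rcfType) (x y : R) :
  `|(x +i* y)%C| <= (`|x| + `|y|)%:C%C.
Proof.
rewrite normc_def /= lecR -[leRHS]ger0_norm ?addr_ge0// -[leRHS]sqrtr_sqr ler_wsqrtr//.
rewrite sqrrD !real_normK ?num_real// addrAC lerDl.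
by rewrite mulrn_wge0// mulr_ge0.
Qed.

Section complex_measurable.
Context {d : measure_display} {T : measurableType d} {R : realType}.
Implicit Types (D : set T) (f g : T -> R[i]).

Definition cmeasurable_fun D f : Prop :=
  measurable_fun D (@complex.Re R \o f) /\ measurable_fun D (@complex.Im R \o f).

Lemma cmeasurable_cst D (c : R[i]) : cmeasurable_fun D (fun=> c).
Proof. by split; exact: measurable_cst. Qed.

Lemma cmeasurable_real D (f : T -> R) :
  measurable_fun D f -> cmeasurable_fun D (fun x => (f x)%:C%C).
Proof. by move=> mf; split => //=; exact: measurable_cst. Qed.

Lemma cmeasurable_funD D f g : cmeasurable_fun D f -> cmeasurable_fun D g ->
  cmeasurable_fun D (fun x => f x + g x).
Proof.
move=> [mf1 mf2] [mg1 mg2]; split.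
- rewrite (_ : _ \o _ = (@complex.Re R \o f) \+ (@complex.Re R \o g)).
    exact: measurable_funD.
  by apply/funext => x /=; case: (f x) (g x) => ? ? [].
- rewrite (_ : _ \o _ = (@complex.Im R \o f) \+ (@complex.Im R \o g)).
    exact: measurable_funD.
  by apply/funext => x /=; case: (f x) (g x) => ? ? [].
Qed.

Lemma cmeasurable_funM D f g : cmeasurable_fun D f -> cmeasurable_fun D g ->
  cmeasurable_fun D (fun x => f x * g x).
Proof.
move=> [mf1 mf2] [mg1 mg2]; split.
- rewrite (_ : _ \o _ = (@complex.Re R \o f) \* (@complex.Re R \o g) \-
      (@complex.Im R \o f) \* (@complex.Im R \o g)).
    by apply: measurable_funB; exact: measurable_funM.
  by apply/funext => x /=; case: (f x) (g x) => ? ? [].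
- rewrite (_ : _ \o _ = (@complex.Re R \o f) \* (@complex.Im R \o g) \+
      (@complex.Im R \o f) \* (@complex.Re R \o g)).
    by apply: measurable_funD; exact: measurable_funM.
  by apply/funext => x /=; case: (f x) (g x) => ? ? [].
Qed.

Lemma cmeasurable_funX D f n : cmeasurable_fun D f ->
  cmeasurable_fun D (fun x => f x ^+ n).
Proof.
move=> mf; elim: n => [|n IH]; first exact: cmeasurable_cst.
by under eq_fun do rewrite exprS; exact: cmeasurable_funM.
Qed.

(** The formula 1/(u+iv) = (u-iv)/(u^2+v^2) also holds at 0, where every inverse is 0 by convention,
    so zeros of [f] need no separate treatment. *)
Lemma cmeasurable_funV D f : cmeasurable_fun D f ->
  cmeasurable_fun D (fun x => (f x)^-1).
Proof.
move=> [mf1 mf2].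
pose n2 x := complex.Re (f x) ^+ 2 + complex.Im (f x) ^+ 2.
have mV : measurable_fun D (GRing.inv \o n2).
  apply: measurableT_comp; first exact: measurable_invr.
  by apply: measurable_funD; exact: measurable_funX.
split.
- rewrite (_ : _ \o _ = (@complex.Re R \o f) \* (GRing.inv \o n2)).
    exact: measurable_funM.
  by apply/funext => x; rewrite /n2 /=; case: (f x).
- rewrite (_ : _ \o _ = (\- (@complex.Im R \o f)) \* (GRing.inv \o n2)).
    by apply: measurable_funM => //; exact: measurable_funN.
  by apply/funext => x; rewrite /n2 /=; case: (f x) => u v; rewrite /= mulNr.
Qed.

End complex_measurable.

Section complex_integral_theory.
Context {d : measure_display} {T : measurableType d} {R : realType}.
Variables (mu : {measure set T -> \bar R}) (D : set T) (mD : measurable D).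
Implicit Types f g : T -> R[i].

Lemma cintegrable_measurable f : cintegrable mu D f -> cmeasurable_fun D f.
Proof.
by move=> [/measurable_int/measurable_EFinP ? /measurable_int/measurable_EFinP].
Qed.

Lemma eq_cintegral f g : {in D, f =1 g} ->
  cintegral mu D f = cintegral mu D g.
Proof.
by move=> fg; congr Complex; apply: eq_Rintegral => x /fg ->.
Qed.

Lemma cintegrableD f g : cintegrable mu D f -> cintegrable mu D g ->
  cintegrable mu D (fun x => f x + g x).
Proof.
move=> [f1 f2] [g1 g2]; split.
- apply: eq_integrable (integrableD mD f1 g1) => // x _ /=.
  by case: (f x) (g x) => ? ? [].
- apply: eq_integrable (integrableD mD f2 g2) => // x _ /=.
  by case: (f x) (g x) => ? ? [].
Qed.

Lemma cintegralD f g : cintegrable mu D f -> cintegrable mu D g ->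
  cintegral mu D (fun x => f x + g x) = cintegral mu D f + cintegral mu D g.
Proof.
move=> [f1 f2] [g1 g2]; rewrite /cintegral; simpc; congr Complex.
- by rewrite -RintegralD//; apply: eq_Rintegral => x _; case: (f x) (g x) => ? ? [].
- by rewrite -RintegralD//; apply: eq_Rintegral => x _; case: (f x) (g x) => ? ? [].
Qed.

Lemma cintegrableZl (c : R[i]) f : cintegrable mu D f ->
  cintegrable mu D (fun x => c * f x).
Proof.
move=> [f1 f2]; case: c => u v; split.
- apply: eq_integrable (integrableB mD (integrableZl mD u f1)
    (integrableZl mD v f2)) => // x _ /=.
  by case: (f x).
- apply: eq_integrable (integrableD mD (integrableZl mD u f2)
    (integrableZl mD v f1)) => // x _ /=.
  by case: (f x).
Qed.

Lemma cintegralZl (c : R[i]) f : cintegrable mu D f ->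
  cintegral mu D (fun x => c * f x) = c * cintegral mu D f.
Proof.
move=> [f1 f2]; case: c => u v; rewrite /cintegral; simpc.
have iZ k (p : T -> R) : mu.-integrable D (EFin \o p) ->
    mu.-integrable D (EFin \o (fun x => k * p x)).
  by move=> /(integrableZl mD k); exact: eq_integrable.
congr Complex.
- rewrite -!RintegralZl// -RintegralB//; [|exact: iZ..].
  by apply: eq_Rintegral => x _; case: (f x).
- rewrite -!RintegralZl// -RintegralD//; [|exact: iZ..].
  by apply: eq_Rintegral => x _; case: (f x).
Qed.

(** Integrability and value go through one induction, because adding a term to the integral requires
    the partial sum to be integrable. *)
Lemma cintegral_sum (c : nat -> R[i]) (f : nat -> T -> R[i]) n :
  (forall k, cintegrable mu D (f k)) ->
  cintegrable mu D (fun x => \sum_(0 <= k < n) c k * f k x) /\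
  cintegral mu D (fun x => \sum_(0 <= k < n) c k * f k x) =
  \sum_(0 <= k < n) c k * cintegral mu D (f k).
Proof.
move=> fi; elim: n => [|n [IH1 IH2]].
  under eq_fun do rewrite big_nil; rewrite big_nil.
  split; first by split; exact: integrable0.
  by rewrite /cintegral /= !Rintegral_cst// !mul0r.
under eq_fun do rewrite big_nat_recr//=; rewrite big_nat_recr//=.
have icf := cintegrableZl (c n) _ (fi n).
by split; [exact: cintegrableD|rewrite cintegralD// IH2 cintegralZl].
Qed.

Hypothesis muD : (mu D < +oo)%E.

Lemma bounded_cintegrable f (M : R) : cmeasurable_fun D f ->
  (forall x, D x -> `|f x| <= M%:C%C) -> cintegrable mu D f.
Proof.
move=> [mf1 mf2] fM; split; apply: measurable_bounded_integrable => //;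
  exists M; split; rewrite ?num_real// => N MN x Dx;
  apply: le_trans (ltW MN); rewrite -lecR; apply: le_trans (fM _ Dx).
- exact: normc_ge_Re.
- exact: normc_ge_Im.
Qed.

(** The factor 2 comes from bounding real and imaginary parts separately; it is harmless for a
    remainder that tends to 0. *)
Lemma norm_cintegral_le f (M : R) : cintegrable mu D f ->
  (forall x, D x -> `|f x| <= M%:C%C) ->
  `|cintegral mu D f| <= (2 * (M * fine (mu D)))%:C%C.
Proof.
move=> [f1 f2] fM; apply: le_trans (normc_le_ReIm _ _ _) _; rewrite lecR.
have bnd (p : T -> R) : mu.-integrable D (EFin \o p) ->
    (forall x, D x -> `|p x| <= M) ->
    `|Rintegral mu D p| <= M * fine (mu D).
  move=> ip pM; apply: le_trans (le_normr_Rintegral _ _) _ => //.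
  rewrite -Rintegral_cst//; apply: le_Rintegral => //.
  - exact: integrable_norm.
  - apply: (@measurable_bounded_integrable _ _ _ _ (cst M)) => //.
    exact: bounded_cst.
rewrite mulr_natl mulr2n lerD// bnd// => x Dx; rewrite -lecR;
  apply: le_trans (fM _ Dx).
- exact: normc_ge_Re.
- exact: normc_ge_Im.
Qed.

End complex_integral_theory.

(** * Pointwise identities and bounds for h/(zh+1) *)

Section integrand.
Context {R : realType}.
Implicit Types (z : R[i]) (t : R).

(** The imaginary part is [t * Im z], which vanishes only for [t = 0], where the value is 1. *)
Lemma affine_neq0 z t : 0 < complex.Im z -> z * t%:C%C + 1 != 0.
Proof.
case: z => x y /= y0; have [->|t0] := eqVneq t 0.
  by rewrite mulr0 add0r oner_neq0.
apply/eqP; simpc => -[_ /eqP]; rewrite mulf_eq0 gt_eqF//= => /eqP t0'.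
by rewrite t0' eqxx in t0.
Qed.

(** The denominator dominates its imaginary part, |zh+1| >= Im z * |h|, and |h| cancels. The bound
    is thus uniform in [t] even for unbounded [h]. *)
Lemma norm_g_integrand (h : R -> R) z t : 0 < complex.Im z ->
  `|g_integrand h z t| <= ((complex.Im z)^-1)%:C%C.
Proof.
move=> z0; rewrite /g_integrand normf_div ler_pdivrMr; last first.
  by rewrite normr_gt0 affine_neq0.
apply: le_trans (_ : ((complex.Im z)^-1 *
    `|complex.Im (z * (h t)%:C%C + 1)|)%:C%C <= _); last first.
  by rewrite rmorphM/= ler_wpM2l ?normc_ge_Im// ler0c invr_ge0 ltW.
have -> : complex.Im (z * (h t)%:C%C + 1) = complex.Im z * h t.
  by case: z {z0} => x y /=; rewrite mulr0 add0r addr0.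
rewrite normc_def /= expr0n addr0 sqrtr_sqr.
by rewrite lecR normrM gtr0_norm// mulKf ?gt_eqF.
Qed.

Lemma Im_g_integrand (h : R -> R) z t :
  complex.Im (g_integrand h z t) =
  - (complex.Im z * h t ^+ 2 / ((complex.Re z * h t + 1) ^+ 2 +
                                (complex.Im z * h t) ^+ 2)).
Proof.
case: z => x y; rewrite /g_integrand /=; simpc => /=.
ring.
Qed.

Lemma g_integrand_i (h : R -> R) t :
  g_integrand h 'i%C t = (h t / (1 + h t ^+ 2) -i* (h t ^+ 2 / (1 + h t ^+ 2)))%C.
Proof.
rewrite /g_integrand; by simpc; rewrite expr1n; congr Complex; ring.
Qed.

Lemma g_integrand_pick (h : R -> R) z t : 0 < complex.Im z ->
  g_integrand h z t = (h t / (1 + h t ^+ 2))%:C%C +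
    (h t ^+ 2 / (1 + h t ^+ 2))%:C%C * pick_kernel z (- (h t)^-1).
Proof.
move=> z0; have := @affine_neq0 z (h t) z0; rewrite /g_integrand /pick_kernel.
(* For [h t = 0] the kernel is taken at the default point 0, but with weight 0, so both sides
   vanish. *)
have [->|h0] := eqVneq (h t) 0 => d0.
  by rewrite expr0n/= !mul0r !(mul0r, addr0).
have p0 : 1 + h t ^+ 2 != 0 by rewrite gt_eqF// ltr_pwDl// sqr_ge0.
have hc0 : (h t)%:C%C != 0 by rewrite -[0]/(0%:C)%C (inj_eq (@complexI R)).
(* A complex number 1 + c^2 may vanish, so this is transported from the reals before [h t] is
   generalized to [c]. The kernel's denominator z + 1/c is (zc+1)/c, nonzero by [d0]. *)
have pc0 : 1 + (h t)%:C%C ^+ 2 != 0 :> R[i].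
  by rewrite -[1]/(1%:C)%C -rmorphXn -rmorphD/= -[0]/(0%:C)%C (inj_eq (@complexI R)).
rewrite !(rmorphM, fmorphV, rmorphD, rmorphXn, rmorphN, rmorph1)/=.
move: {h0 p0}(h t)%:C%C hc0 pc0 d0 => c c0 c1 d0.
field.
by rewrite -expr2 c1 c0 d0.
Qed.

(** Writing G for the integrand, this iterates the resolvent identity G(z) = G(z0) + (z0 - z) G(z)
    G(z0). With an exact remainder, only finite sums have to be integrated. *)
Lemma g_integrand_geometric (h : R -> R) z0 z t n :
  0 < complex.Im z0 -> 0 < complex.Im z ->
  g_integrand h z t =
  \sum_(0 <= k < n) (z0 - z) ^+ k * g_integrand h z0 t ^+ k.+1 +
  g_integrand h z t * ((z0 - z) * g_integrand h z0 t) ^+ n.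
Proof.
move=> z0P zP; elim: n => [|n IH]; first by rewrite big_nil add0r expr0 mulr1.
rewrite big_nat_recr//= {1}IH -addrA; congr (_ + _).
have := affine_neq0 _ (h t) z0P; have := affine_neq0 _ (h t) zP => dz dz0.
have {1}-> : g_integrand h z t =
    g_integrand h z0 t + g_integrand h z t * ((z0 - z) * g_integrand h z0 t).
  rewrite /g_integrand; field.
  by rewrite dz dz0.
rewrite mulrDl -mulrA -exprS; congr (_ + _).
move: (g_integrand h z0 t) (z0 - z) => w u.
by rewrite exprMn exprS mulrCA.
Qed.

End integrand.

(** * Analyticity of g and the sign of its imaginary part *)

Section analytic.
Context {R : realType}.
Local Notation RT := (measurableTypeR R).
Variables (mu : {measure set RT -> \bar R}) (a b : R) (h : R -> R).
Hypothesis mufin : (mu `]a, b]%classic < +oo)%E.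
Hypothesis gi : forall z, upper_half_plane z ->
  cintegrable mu `]a, b] (g_integrand h z).

(** The ratio 1/2 is the product of the bounds [Im z0 / 2] on |z0 - z| and 1/[Im z0] on |G(z0)|; the
    remaining factor G(z) contributes 1/[Im z]. *)
Lemma norm_g_taylor z0 z n : 0 < complex.Im z0 ->
  `|z0 - z| <= (complex.Im z0 / 2)%:C%C -> 0 < complex.Im z ->
  `|g mu a b h z - \sum_(0 <= k < n) (z0 - z) ^+ k *
      cintegral mu `]a, b] (fun t => g_integrand h z0 t ^+ k.+1)|
  <= (2 * ((complex.Im z)^-1 * 2^-1 ^+ n * fine (mu `]a, b]%classic)))%:C%C.
Proof.
move=> z0P zz0 zP; set w := g_integrand h z0.
have mD : measurable (`]a, b] : set RT) by [].
have wX k : cintegrable mu `]a, b] (fun t => w t ^+ k.+1).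
  apply: (@bounded_cintegrable _ _ _ _ _ mD mufin _ ((complex.Im z0)^-1 ^+ k.+1)).
    by apply: cmeasurable_funX; exact: cintegrable_measurable (gi _ z0P).
  move=> t _; rewrite normrX rmorphXn/= lerXn2r ?nnegrE//.
    by rewrite ler0c invr_ge0 ltW.
  exact: norm_g_integrand.
have rem_le t : `|g_integrand h z t * ((z0 - z) * w t) ^+ n| <=
    ((complex.Im z)^-1 * 2^-1 ^+ n)%:C%C.
  rewrite normrM rmorphM/=; apply: ler_pM => //; first exact: norm_g_integrand.
  rewrite normrX rmorphXn/= lerXn2r ?nnegrE//.
    by rewrite ler0c invr_ge0.
  rewrite normrM.
  apply: le_trans (ler_pM _ _ zz0 (norm_g_integrand h _ t z0P)) _ => //.
  by rewrite -rmorphM/= lecR mulrAC mulfV ?gt_eqF// mul1r.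
have remi : cintegrable mu `]a, b]
    (fun t => g_integrand h z t * ((z0 - z) * w t) ^+ n).
  apply: (@bounded_cintegrable _ _ _ _ _ mD mufin) (fun t _ => rem_le t).
  apply: cmeasurable_funM; first exact: cintegrable_measurable (gi _ zP).
  apply: cmeasurable_funX.
  apply: cmeasurable_funM; first exact: cmeasurable_cst.
  exact: cintegrable_measurable (gi _ z0P).
have [si sE] := @cintegral_sum _ _ _ _ _ mD
  (fun k => (z0 - z) ^+ k) (fun k t => w t ^+ k.+1) n wX.
rewrite /g (@eq_cintegral _ RT _ _ _ _
  (fun t => \sum_(0 <= k < n) (z0 - z) ^+ k * w t ^+ k.+1 +
     g_integrand h z t * ((z0 - z) * w t) ^+ n)); last first.
  by move=> t _; exact: g_integrand_geometric.
rewrite cintegralD// sE.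
rewrite addrAC subrr add0r.
exact: norm_cintegral_le.
Qed.

Lemma analytic_g : analytic_on upper_half_plane (g mu a b h).
Proof.
move=> z0 z0P; set y0 := complex.Im z0.
have y0_gt0 : 0 < y0 by exact: z0P.
(* The geometric expansion is in powers of [z0 - z], hence the signs. *)
exists (fun k => (-1) ^+ k *
  cintegral mu `]a, b] (fun t => g_integrand h z0 t ^+ k.+1)).
have r0 : (0 : R[i]) < (y0 / 2)%:C%C by rewrite ltcR divr_gt0.
have near_z : \forall z \near z0, `|z0 - z| < (y0 / 2)%:C%C.
  exact: (@cvgr_dist_lt _ _ _ (nbhs z0) _ id).
near=> z.
have zz0 : `|z0 - z| < (y0 / 2)%:C%C by near: z.
(* [Im z] is within [y0 / 2] of [y0], so the disc stays in the upper half-plane. *)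
have zP : 0 < complex.Im z.
  have := le_lt_trans (normc_ge_Im _ (z0 - z)) zz0.
  rewrite ltcR raddfB/= -/y0 ltr_norml => /andP[_ +].
  lra.
apply/cvgrPdist_lt => e e0.
(* The order of [R[i]] only compares numbers with equal imaginary parts, so [0 < e] forces [e] to be
   real. *)
have e0' : 0 < complex.Re e by move: e0; rewrite ltcE => /andP[].
have eE : e = (complex.Re e)%:C%C.
  by case: (e) (e0) => u v; rewrite ltcE /= => /andP[/eqP ->].
set C := 2 * ((complex.Im z)^-1 * fine (mu `]a, b]%classic)).
have half_lt1 : `|2^-1 : R| < 1.
  by rewrite ger0_norm ?invr_ge0// invf_lt1// ltr1n.
have /cvgrPdist_lt/(_ _ e0') geo := @cvg_geometric R C _ half_lt1.
near=> n.
rewrite eE /series/= (eq_bigr (fun k => (z0 - z) ^+ k *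
    cintegral mu `]a, b] (fun t => g_integrand h z0 t ^+ k.+1))); last first.
  by move=> k _; rewrite mulrAC -exprMn mulN1r opprB.
apply: le_lt_trans (norm_g_taylor _ _ n z0P (ltW zz0) zP) _.
rewrite ltcR; apply: le_lt_trans (_ : `|0 - geometric C 2^-1 n| < _); last first.
  by near: n.
rewrite sub0r normrN /geometric/= /C; apply: le_trans (ler_norm _).
by rewrite le_eqVlt; apply/orP; left; apply/eqP; ring.
Unshelve. all: by end_near. Qed.

(** If [h] vanished almost everywhere, g would be 0, outside the open half-plane. Otherwise -Im g is
    the integral of some [F >= 0], and a zero integral would give [F = 0], hence [h = 0], almost
    everywhere. *)
Lemma Im_g_lt0 : ~ {ae mu, forall s, s \in `]a, b] -> h s = 0} ->
  forall z, upper_half_plane z -> lower_half_plane (g mu a b h z).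
Proof.
move=> hN0 z zP.
pose F s := - complex.Im (g_integrand h z s).
have mD : measurable (`]a, b] : set RT) by [].
have z0 : 0 < complex.Im z by exact: zP.
have F0 s : 0 <= F s.
  rewrite /F Im_g_integrand opprK divr_ge0// ?addr_ge0 ?sqr_ge0//.
  by rewrite mulr_ge0 ?sqr_ge0// ltW.
have iF : mu.-integrable `]a, b] (EFin \o F).
  have [_ /(integrableZl mD (-1))] := gi z zP.
  by apply: eq_integrable => //= x _; rewrite /F -EFinM mulN1r.
have gF : complex.Im (g mu a b h z) = - Rintegral mu `]a, b] F.
  have [_ iI] := gi z zP.
  rewrite /g /cintegral /= -mulN1r -RintegralZl//.
  by apply: eq_Rintegral => x _; rewrite /F mulrN mulN1r opprK.
rewrite /lower_half_plane/= [ltLHS]gF oppr_lt0 lt_neqAle Rintegral_ge0; last first.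
  by move=> x _; exact: F0.
rewrite andbT.
apply/negP => /eqP/esym F00; apply: hN0.
have /integrableP[mF _] := iF.
have /(ae_eq_integral_abs mu mD mF) : (\int[mu]_(x in `]a, b]) `|(EFin \o F) x| = 0)%E.
  under eq_integral do rewrite /= ger0_norm//.
  rewrite -[LHS]fineK ?integrable_fin_num//.
  by congr _%:E.
apply: filterS => x /= + sD; rewrite inE in sD => /(_ sD)[].
(* A zero quotient means a zero numerator, so [h x = 0], or a zero denominator; the latter forces
   [h x = 0] through its second square, and then the first square is 1. *)
rewrite /F Im_g_integrand opprK => /eqP.
rewrite !mulf_eq0 gt_eqF//= invr_eq0 orbb => /orP[/eqP//|].
rewrite paddr_eq0 ?sqr_ge0// => /andP[].
rewrite !sqrf_eq0 => /[swap]; rewrite mulf_eq0 gt_eqF//= => /eqP ->.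
by rewrite mulr0 add0r oner_eq0.
Qed.

End analytic.

(** * The Pick-Nevanlinna representation *)

Lemma cmeasurable_pick_kernel (R : realType) (z : R[i]) :
  cmeasurable_fun [set: measurableTypeR R] (pick_kernel z).
Proof.
apply: cmeasurable_funM.
  apply: cmeasurable_funD; first exact: cmeasurable_cst.
  apply: cmeasurable_funM; first exact: cmeasurable_cst.
  exact: cmeasurable_real.
apply: cmeasurable_funV; apply: cmeasurable_funD; first exact: cmeasurable_cst.
under eq_fun do rewrite -rmorphN/=.
exact: cmeasurable_real.
Qed.

Section complex_weighted_image.
Context {d1 d2 : measure_display} {X : measurableType d1}
  {Y : measurableType d2} {R : realType}.
Variables (mu : {measure set X -> \bar R}) (D : set X) (k : X -> R)
  (phi : X -> Y).
Hypotheses (mD : measurable D) (mk : measurable_fun D k)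
  (mphi : measurable_fun D phi) (k_ge0 : forall x, 0 <= k x).
Variable f : Y -> R[i].
Hypothesis mf : cmeasurable_fun setT f.

Local Notation nu := (weighted_image_measure mu D k phi mD mk mphi k_ge0).

Lemma cintegrable_weighted_image :
  cintegrable mu D (fun x => (k x)%:C%C * f (phi x)) -> cintegrable nu setT f.
Proof.
move=> [i1 i2]; split.
- apply: integrable_weighted_image; first exact: mf.1.
  by apply: eq_integrable i1 => // x _; case: (f _) => u v; simpc.
- apply: integrable_weighted_image; first exact: mf.2.
  by apply: eq_integrable i2 => // x _; case: (f _) => u v; simpc.
Qed.

Lemma cintegral_weighted_image :
  cintegral nu setT f = cintegral mu D (fun x => (k x)%:C%C * f (phi x)).
Proof.
congr Complex; rewrite /Rintegral integral_weighted_image; do ?[exact: mf.1|exact: mf.2];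
  by congr fine; apply: eq_integral => x _; case: (f _) => u v; simpc.
Qed.

End complex_weighted_image.

(** Since [m] is a bare set function, integration against it goes through a bundled finite measure
    [mm] that agrees with it on measurable sets. *)
Theorem lemma1 (R : realType) (a b : R) (h r : R -> R)
    (ab : a < b)
    (r_ge0 : {in `]a, b], forall s, 0 <= r s})
    (r_nd : {in `]a, b] &, {homo r : s t / s <= t}})
    (mh : measurable_fun (`]a, b] : set (measurableTypeR R)) h) :
  let dr : {measure set (measurableTypeR R) -> \bar R} := stieltjes ab r_ge0 in
  (forall z, upper_half_plane z ->
     cintegrable dr `]a, b] (g_integrand h z)) ->
  [/\ ~ {ae dr, forall s, s \in `]a, b] -> h s = 0} ->
        forall z, upper_half_plane z -> lower_half_plane (g dr a b h z),
      analytic_on (upper_half_plane) (g dr a b h) &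
      dr.-integrable `]a, b] (fun s => (h s / (1 + h s ^+ 2))%:E) /\
      exists mm : {finite_measure set (measurableTypeR R) -> \bar R},
        (forall A, measurable A -> mm A = m dr a b h A) /\
        forall z, upper_half_plane z ->
          cintegrable mm setT (pick_kernel z) /\
          g dr a b h z =
            (Rintegral dr `]a, b] (fun s => h s / (1 + h s ^+ 2)))%:C%C
            + cintegral mm setT (pick_kernel z)].
Proof.
move=> dr gi.
have mD : measurable (`]a, b] : set (measurableTypeR R)) by [].
have drfin : (dr `]a, b]%classic < +oo)%E.
  by rewrite /dr stieltjes_itv ?ltW// ltry.
split.
- exact: Im_g_lt0.
- exact: analytic_g.
pose l s := h s / (1 + h s ^+ 2); pose k s := h s ^+ 2 / (1 + h s ^+ 2).
pose phi s := - (h s)^-1.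
have [] : cintegrable dr `]a, b] (g_integrand h 'i%C).
  by apply: gi; rewrite /upper_half_plane/=.
move=> iRe iIm.
have il : dr.-integrable `]a, b] (EFin \o l).
  by apply: eq_integrable iRe => // s _; rewrite (g_integrand_i h s).
have ik : dr.-integrable `]a, b] (EFin \o k).
  apply: eq_integrable (integrableZl mD (-1) iIm) => // s _.
  by rewrite (g_integrand_i h s)/= -EFinM mulN1r opprK.
split=> //.
have k_ge0 s : 0 <= k s.
  by apply: divr_ge0; [exact: sqr_ge0|apply: addr_ge0 => //; exact: sqr_ge0].
have mk : measurable_fun `]a, b] k.
  by have /measurable_int/measurable_EFinP := ik.
have mphi : measurable_fun (`]a, b] : set (measurableTypeR R))
    (phi : measurableTypeR R -> measurableTypeR R).
  apply: measurable_funN.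
  by apply: measurableT_comp mh; exact: measurable_invr.
(* Agreement with [m] then holds by unfolding. *)
exists (@weighted_image_finite_measure _ _ (measurableTypeR R)
  (measurableTypeR R) R dr `]a, b] k phi mD mk mphi k_ge0 ik).
split=> // z zP.
have ilc : cintegrable dr `]a, b] (fun s => (l s)%:C%C).
  by split=> //=; exact: integrable0.
have gE s : g_integrand h z s = (l s)%:C%C + (k s)%:C%C * pick_kernel z (phi s).
  exact: g_integrand_pick.
have ipick : cintegrable dr `]a, b] (fun s => (k s)%:C%C * pick_kernel z (phi s)).
  (* The weighted kernel is integrable as the difference of two integrable functions, by the
     pointwise identity [gE]. *)
  rewrite (_ : (fun s => _) = fun s => g_integrand h z s + (-1) * (l s)%:C%C).
    by apply: cintegrableD => //; [exact: gi|exact: cintegrableZl].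
  by apply/funext => s; rewrite gE mulN1r addrAC subrr add0r.
split.
  exact: (@cintegrable_weighted_image _ _ (measurableTypeR R)
    (measurableTypeR R) R dr `]a, b] k phi mD mk mphi k_ge0 _
    (cmeasurable_pick_kernel _ z)).
have -> := @cintegral_weighted_image _ _ (measurableTypeR R)
    (measurableTypeR R) R dr `]a, b] k phi mD mk mphi k_ge0 _
    (cmeasurable_pick_kernel _ z).
rewrite /g (@eq_cintegral _ (measurableTypeR R) _ _ _ _ (fun s => _)
  (fun s _ => gE s)) cintegralD//; congr (_ + _).
(* The integrand [l] is real, so the imaginary part is the integral of the constant 0. *)
by congr Complex; rewrite Rintegral_cst// mul0r.
Qed.
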